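(* Let $\pi_\theta$ and $\pi_{\mathrm{ref}}$ be two reverse policies of a diffusion language model with the same masking schedule and with categorical predictions $\mu_\theta$ and $\mu_{\mathrm{ref}}$ respectively, and assume that the reverse kernels factorize across coordinates, i.e. $\pi_\bullet(\boldsymbol{\tau}_{t-1} \mid \boldsymbol{\tau}_t, t) = \prod_{i=1}^L p_\bullet(\tau_{t-1}^{(i)} \mid \tau_t^{(i)}, \boldsymbol{\tau}_t, \mu_\bullet)$ for $\bullet \in \{\theta, \mathrm{ref}\}$, with $p_\bullet$ the coordinatewise reverse kernel defined in the context. Then for any $t \in \{1,\dots,T\}$ and any $(\boldsymbol{\tau}_{t-1}, \boldsymbol{\tau}_t) \in \bar{\mathcal{V}}^L \times \bar{\mathcal{V}}^L$ with $\pi_{\mathrm{ref}}(\boldsymbol{\tau}_{t-1} \mid \boldsymbol{\tau}_t, t) > 0$, $$\frac{\pi_\theta(\boldsymbol{\tau}_{t-1} \mid \boldsymbol{\tau}_t, t)}{\pi_{\mathrm{ref}}(\boldsymbol{\tau}_{t-1} \mid \boldsymbol{\tau}_t, t)} = \prod_{i \in \mathcal{I}_t(\boldsymbol{\tau}_{t-1}, \boldsymbol{\tau}_t)} \frac{\mu_\theta\bigl(\tau_{t-1}^{(i)} \mid \boldsymbol{\tau}_t\bigr)}{\mu_{\mathrm{ref}}\bigl(\tau_{t-1}^{(i)} \mid \boldsymbol{\tau}_t\bigr)},$$ where $\mathcal{I}_t(\boldsymbol{\tau}_{t-1}, \boldsymbol{\tau}_t) := \{ i \in \{1,\dots,L\}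 : \tau_t^{(i)} = [\mathbf{M}],\ \tau_{t-1}^{(i)} \in \mathcal{V} \}$ is the set of newly unmasked coordinates at step $t$.
   Context: $\mathcal{V}$ is a finite vocabulary, $[\mathbf{M}] \notin \mathcal{V}$ is a special mask token, and $\bar{\mathcal{V}} = \mathcal{V} \cup \{[\mathbf{M}]\}$. States are sequences $\boldsymbol{\tau}_t \in \bar{\mathcal{V}}^L$ of fixed length $L$, indexed by time $t \in \{0,1,\dots,T\}$; $\tau_t^{(i)}$ is the token at position $i$. The reverse process goes from $\boldsymbol{\tau}_t$ to $\boldsymbol{\tau}_{t-1}$. Masking schedule: $\beta_t \in [0,1]$ for $t = 1,\dots,T$, and $\alpha_t = \prod_{r=1}^t (1-\beta_r)$ with $\alpha_0 = 1$; it is assumed that $\alpha_t < 1$ for $t \ge 1$, so that the coefficients below are defined. Models: for $\bullet \in \{\theta, \mathrm{ref}\}$, every state $\boldsymbol{\tau}_t$ and every position $i$, the network gives a categorical distribution $\mu_\bullet(\cdot \mid \boldsymbol{\tau}_t)$ over $\mathcal{V}$ at position $i$ (a softmax of logits, so all probabilities are positive). The coordinatewise reverse kernel is $$p_\bullet(\tau_{t-1}^{(i)} \mid \tau_t^{(i)}, \boldsymbol{\tau}_t, \mu_\bullet) = \begin{cases} \frac{\alpha_{t-1}-\alpha_t}{1-\alpha_t}\, \mu_\bullet(\tau_{t-1}^{(i)} \mid \boldsymbol{\tau}_t) & \tau_t^{(i)} = [\mathbf{M}],\ \tau_{t-1}^{(i)} \ne [\mathbf{M}], \\ \frac{1-\alpha_{t-1}}{1-\alpha_t}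 & \tau_t^{(i)} = [\mathbf{M}],\ \tau_{t-1}^{(i)} = [\mathbf{M}], \\ 1 & \tau_t^{(i)} \ne [\mathbf{M}],\ \tau_{t-1}^{(i)} = \tau_t^{(i)}, \\ 0 & \text{otherwise,} \end{cases}$$ where $\mu_\bullet(\tau_{t-1}^{(i)} \mid \boldsymbol{\tau}_t)$ is the probability of the token $\tau_{t-1}^{(i)}$ at position $i$. Everything is implicitly conditioned on a fixed prompt. An empty product equals $1$. *)

(* Defs.v *)
From mathcomp Require Import all_boot all_order all_algebra reals.

Set Implicit Arguments.
Unset Strict Implicit.
Unset Printing Implicit Defensive.

Import Order.TTheory GRing.Theory Num.Theory.
Local Open Scope ring_scope.

Record dist (R : realType) (A : finType) := Dist {
  pmf :> A -> R;
  pmf_ge0 : forall a, 0 <= pmf a;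
  pmf_sum1 : \sum_(a : A) pmf a = 1
}.

(* The extended vocabulary is [option V]: the mask token is [None], which is
   by construction not in [V], and [Some v] is the ordinary token [v]. *)
Definition mask {V : finType} : option V := None.

Notation state V L := (L.-tuple (option V)).

(* [mu x i] is the categorical distribution predicted at position [i] in
   state [x]. *)
Notation predictor R V L := (state V L -> 'I_L -> dist R V).

(* [pi t x y] is the probability of moving from the state [x] at time [t] to
   the state [y] at time [t - 1]. *)
Notation policy R V L := (nat -> state V L -> dist R (state V L)).

Definition alpha (R : realType) (beta : nat -> R) (t : nat) : R :=
  \prod_(1 <= r < t.+1) (1 - beta r).

(* A distribution over [V], seen as one over [option V] with no mass on the
   mask; the value at the mask is used neither by [rev_kernel] nor in a product
   over [newly_unmasked]. *)
Definition tok_prob (R : realType) (V : finType) (m : dist R V)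
    (o : option V) : R :=
  if o is Some v then m v else 0.

(* [a] is the token at time [t], [b] the token at time [t - 1], and [m] the
   prediction at the position under consideration. *)
Definition rev_kernel (R : realType) (V : finType) (beta : nat -> R) (t : nat)
    (m : dist R V) (a b : option V) : R :=
  if (a == mask) && (b != mask) then
    (alpha beta t.-1 - alpha beta t) / (1 - alpha beta t) * tok_prob m b
  else if (a == mask) && (b == mask) then
    (1 - alpha beta t.-1) / (1 - alpha beta t)
  else if (a != mask) && (b == a) then 1
  else 0.

Definition factorizes (R : realType) (V : finType) (L T : nat)
    (beta : nat -> R) (mu : predictor R V L) (pi : policy R V L) : Prop :=
  forall (t : nat) (x y : state V L), (1 <= t <= T)%N ->
    pi t x y =
    \prod_(i < L) rev_kernel beta t (mu x i) (tnth x i) (tnth y i).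

Definition newly_unmasked (V : finType) (L : nat) (y x : state V L) :
    {set 'I_L} :=
  [set i | (tnth x i == mask) && (tnth y i != mask)].

(* Main.v *)
Require Import Defs.
From mathcomp Require Import all_boot all_order all_algebra reals.

Import Order.TTheory GRing.Theory Num.Theory.
Local Open Scope ring_scope.

(** Both policies are products over coordinates, so their ratio is a product of kernel ratios, each
    computed by [rev_kernel_ratio]. The prediction enters a kernel only where a mask is replaced by
    a token, next to a schedule coefficient common to both policies, which cancels; elsewhere the
    two kernels coincide. *)

Lemma rev_kernel_ratio (R : realType) (V : finType) (beta : nat -> R) (t : nat)
    (m m' : dist R V) (a b : option V) :
  rev_kernel beta t m' a b != 0 ->
  rev_kernel beta t m a b / rev_kernel beta t m' a b =
  if (a == Defs.mask) && (b != Defs.mask) then tok_prob m b / tok_prob m' b else 1.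
Proof.
rewrite /rev_kernel; case: ifP => _; last exact: divff.
(* The nonzero kernel forces its schedule coefficient to be nonzero, which is what permits the
   cancellation. *)
by rewrite mulf_eq0 negb_or -mulf_div => /andP[/divff-> _]; rewrite mul1r.
Qed.

Theorem theorem3p2 (R : realType) (V : finType) (L T : nat) (beta : nat -> R)
    (beta01 : forall r : nat, (1 <= r <= T)%N -> 0 <= beta r <= 1)
    (alpha_lt1 : forall r : nat, (1 <= r <= T)%N -> alpha beta r < 1)
    (mu_theta mu_ref : predictor R V L)
    (mu_theta_gt0 : forall (x : state V L) (i : 'I_L) (v : V),
        0 < mu_theta x i v)
    (mu_ref_gt0 : forall (x : state V L) (i : 'I_L) (v : V),
        0 < mu_ref x i v)
    (pi_theta pi_ref : policy R V L)
    (pi_theta_fact : factorizes T beta mu_theta pi_theta)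
    (pi_ref_fact : factorizes T beta mu_ref pi_ref)
    (t : nat) (ht : (1 <= t <= T)%N)
    (tau_prev tau_t : state V L)
    (pi_ref_gt0 : 0 < pi_ref t tau_t tau_prev) :
  pi_theta t tau_t tau_prev / pi_ref t tau_t tau_prev =
  \prod_(i in newly_unmasked tau_prev tau_t)
     (tok_prob (mu_theta tau_t i) (tnth tau_prev i) /
      tok_prob (mu_ref tau_t i) (tnth tau_prev i)).
Proof.
move: pi_ref_gt0; rewrite pi_theta_fact // pi_ref_fact // => /lt0r_neq0.
(* Positivity of the whole reference transition makes each coordinate factor nonzero, which excludes
   the zero branch of the kernel. *)
move=> /prodf_neq0 ref_neq0.
(* Padding the right side with 1 outside [newly_unmasked] matches the [else 1] of [rev_kernel_ratio]
   coordinate by coordinate. *)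
rewrite -prodf_div [RHS]big_mkcond; apply: eq_bigr => i _.
by rewrite inE rev_kernel_ratio ?ref_neq0.
Qed.
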